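(* Let $G=(V,E)$ be a finite, connected plane graph whose medial graph has $c$ components, with associated vectors $v_1,\dots,v_c\in \mathrm{GF}(2)^{|E|}$, and let $v_1,\dots,v_{c-1}$ be the resulting basis of the bicycle space of $G$. For $j=1,\dots,c-1$, pick an edge $e_j\in E$ such that $v_j$ has a $1$ in the position of $e_j$ and $v_k$ has a $0$ in the position of $e_j$ for all $k<j$. Such a set $\mathcal S=\{e_1,\dots,e_{c-1}\}$ can be found, and the set $\mathcal S$ (each edge being identified with the corresponding standard basis vector of $\mathrm{GF}(2)^{|E|}$) forms a basis for the quotient space $\mathrm{GF}(2)^{|E|}/(U+U^* )$.
   Context: $\mathrm{GF}(2)=\mathbb Z/2\mathbb Z$. A plane graph is a graph embedded on the sphere; graphs may have loops and multiple edges. Fix an ordering of $E$, and use the induced ordering on the edges $E^*$ of the dual graph $G^*=(V^*,E^* )$ via the bijection between edges and dual edges, so that subsets of $E$ and of $E^*$ are identified with vectors in $\mathrm{GF}(2)^{|E|}$. The cocycle space (cut space) $U\subseteq \mathrm{GF}(2)^{|E|}$ of $G$ is the row space of the incidence matrix of $G$ over $\mathrm{GF}(2)$ (the row of a vertex has a $1$ exactly at the non-loop edges incident to it); $U^*\subseteq \mathrm{GF}(2)^{|E|}$ is the cocycle space of $G^*$. The cycle space of $G$ is the orthogonal complement $U^\perp$ with respect to the standard inner product, and the bicycle space of $G$ is $U\cap U^\perp$ (for plane graphs $U^*=U^\perp$, so it equals $U\cap U^*$). The medial graph of $G$ is the 4-valent graph on the sphere with one vertex at the midpoint of each edge of $G$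 and, for each corner of a face (a pair of consecutive edge-ends around a vertex), one arc joining the midpoints of the two edges meeting at that corner (if $G$ is a single vertex without edges, it is one circle). Its components $k_1,\dots,k_c$ are the closed curves traced out by going straight ahead (leaving along the opposite arc) at every vertex of the medial graph. The edges of $G$ met when tracing along $k_i$ form a cycle in both $G$ and $G^*$, and $v_i\in\mathrm{GF}(2)^{|E|}$ is the vector of this cycle: it has a $1$ in the position of an edge $e$ if and only if $k_i$ passes through the midpoint of $e$ an odd number of times, i.e. exactly once. For plane graphs $v_1,\dots,v_c$ span the bicycle space, which has dimension $c-1$, and any $c-1$ of them form a basis.
   Formalization: Such a set S need not exist for a fixed numbering (path with two doubled edges, v_1=1111, v_2=1100); it is shown that, whichever component is left out, v_1,…,v_{c-1} can be renumbered so that S can be found; the basis claim holds for every numbering. *)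

(* Defs.v *)
From HB Require Import structures.
From mathcomp Require Import all_boot all_order all_fingroup all_algebra.

Set Implicit Arguments.
Unset Strict Implicit.
Unset Printing Implicit Defensive.

Import GRing.Theory.
Local Open Scope ring_scope.
Local Open Scope quotient_scope.

(** * Quotient of a finite-dimensional space by a subspace *)

(* [quotv W] is the library's additive quotient of [vT] by [W]; it is equipped
   here with its vector space structure. The class of [x] is [quotv_pi W x].   *)
Definition quotv (K : fieldType) (vT : vectType K) (W : {vspace vT}) : Type :=
  Quotient.quot W.

HB.instance Definition _ (K : fieldType) (vT : vectType K) (W : {vspace vT}) :=
  GRing.Zmodule.on (quotv W).

Definition quotv_pi (K : fieldType) (vT : vectType K) (W : {vspace vT})
  (x : vT) : quotv W := \pi_(Quotient.quot W) x.

Section QuotientSpace.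
Variables (K : fieldType) (vT : vectType K) (W : {vspace vT}).
Local Notation pi := (@quotv_pi K vT W).
Local Notation rep q := (generic_quotient.repr (q : Quotient.quot W)).

Lemma quotv_piP (x y : vT) : reflect (pi x = pi y) (x - y \in W).
Proof. by rewrite Quotient.idealrBE; apply: eqP. Qed.

Lemma quotv_piD (x y : vT) : pi (x + y) = pi x + pi y.
Proof. exact: (raddfD (\pi_(Quotient.quot W))). Qed.

Lemma quotv_reprK (q : quotv W) : pi (rep q) = q.
Proof. exact: reprK. Qed.

Definition quotv_scale (a : K) (q : quotv W) : quotv W :=
  pi (a *: rep q).

Lemma quotv_scaleE (a : K) (x : vT) : quotv_scale a (pi x) = pi (a *: x).
Proof.
by apply/quotv_piP; rewrite -scalerBr memvZ //; apply/quotv_piP/quotv_reprK.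
Qed.

Fact quotv_scaleA (a b : K) (q : quotv W) :
  quotv_scale a (quotv_scale b q) = quotv_scale (a * b) q.
Proof. by rewrite -(quotv_reprK q) !quotv_scaleE scalerA. Qed.

Fact quotv_scale1 : left_id 1 quotv_scale.
Proof. by move=> q; rewrite -(quotv_reprK q) quotv_scaleE scale1r. Qed.

Fact quotv_scaleDr : right_distributive quotv_scale +%R.
Proof.
move=> a q r; rewrite -(quotv_reprK q) -(quotv_reprK r).
by rewrite -quotv_piD !quotv_scaleE scalerDr quotv_piD.
Qed.

Fact quotv_scaleDl (q : quotv W) : {morph quotv_scale^~ q : a b / a + b}.
Proof.
by move=> a b /=; rewrite -(quotv_reprK q) !quotv_scaleE scalerDl quotv_piD.
Qed.

HB.instance Definition _ := GRing.Zmodule_isLmodule.Build K (quotv W)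
  quotv_scaleA quotv_scale1 quotv_scaleDr quotv_scaleDl.

Fact quotv_pi_is_linear : linear (quotv_pi W).
Proof. by move=> a x y; rewrite quotv_piD -quotv_scaleE. Qed.

HB.instance Definition _ := GRing.isLinear.Build K vT (quotv W) _ (quotv_pi W)
  quotv_pi_is_linear.

Let p := daddv_pi W^C W.

Let p_sub (x : vT) : x - p x \in W.
Proof.
have dWC : (W^C :&: W = 0)%VS by rewrite capvC capv_compl.
have := @daddv_pi_add _ _ W^C W x dWC.
rewrite addvC addv_complf memvf => /(_ isT) {1}<-.
by rewrite addrC addKr memv_pi.
Qed.

Let p_ker (x : vT) : x \in W -> p x = 0.
Proof.
move=> xW; apply/eqP; rewrite -memv0 -(capv_compl W) memv_cap memv_pi andbT.
by rewrite -[p x](subKr x) memvB.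
Qed.

Let coords (q : quotv W) : 'rV[K]_(\dim W^C) :=
  \row_i coord (vbasis W^C) i (p (rep q)).

Let coords_pi (x : vT) : coords (pi x) = \row_i coord (vbasis W^C) i (p x).
Proof.
have e : p (rep (pi x)) = p x.
  apply/eqP; rewrite -subr_eq0 -[_ - _]linearB; apply/eqP/p_ker.
  by apply/quotv_piP/quotv_reprK.
by apply/rowP=> i; rewrite !mxE e.
Qed.

Fact quotv_vect_iso : Vector.axiom (\dim W^C) (quotv W).
Proof.
exists coords.
  move=> a q r; rewrite -(quotv_reprK q) -(quotv_reprK r) -linearP !coords_pi.
  by apply/rowP=> i; rewrite !mxE !linearP.
pose back (u : 'rV[K]_(\dim W^C)) := pi (\sum_i u 0 i *: (vbasis W^C)`_i).
exists back => [q|u].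
  rewrite -(quotv_reprK q) coords_pi; apply/esym/quotv_piP.
  under eq_bigr do rewrite mxE.
  by rewrite -coord_vbasis ?memv_pi ?p_sub.
rewrite coords_pi; apply/rowP=> i; rewrite mxE /p daddv_pi_id.
- by rewrite coord_sum_free // (basis_free (vbasisP _)).
- by rewrite capvC capv_compl.
by apply: memv_suml => j _; apply/memvZ/vbasis_mem/mem_nth; rewrite size_tuple.
Qed.

HB.instance Definition _ :=
  Lmodule_hasFinDim.Build K (quotv W) quotv_vect_iso.

End QuotientSpace.

(** * Embedded graphs *)

(* The edges are the elements of ['I_m]; the edge-ends (darts) of [e] are
   [(e, false)] and [(e, true)].                                               *)
Definition dart (m : nat) : finType := ('I_m * bool)%type.

Definition rev_dart (m : nat) (d : dart m) : dart m := (d.1, ~~ d.2).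

Lemma rev_dartK (m : nat) : involutive (@rev_dart m).
Proof. by case=> e b; rewrite /rev_dart /= negbK. Qed.

Definition rev_perm (m : nat) : {perm dart m} := perm (inv_inj (@rev_dartK m)).

(* A graph, with loops and multiple edges allowed, together with a rotation
   system: [rot] sends an edge-end to the next one counterclockwise around the
   vertex it is attached to. A vertex without edge-ends is an isolated vertex. *)
Record embedded_graph (m : nat) := EmbeddedGraph {
  vertex : finType;
  rot : {perm dart m};
  src : dart m -> vertex;
  srcP : forall d d' : dart m, (src d == src d') = (d' \in porbit rot d) }.

Section EmbeddedGraph.
Variables (m : nat) (G : embedded_graph m).

(* [face_perm] follows a boundary walk with the face on its left. *)
Definition face_perm : {perm dart m} := (rev_perm m * (rot G)^-1)%g.

Lemma face_permE (d : dart m) : face_perm d = (rot G)^-1%g (rev_dart d).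
Proof. by rewrite permM [rev_perm m d]permE. Qed.

(* A face is represented by the set of edge-ends having it on their left; the
   unique face of an edgeless connected graph has none.                        *)
Definition faces : {set {set dart m}} :=
  if m == 0%N then [set set0] else porbits face_perm.

Definition adjacent : rel (vertex G) :=
  [rel u v | [exists d : dart m, (src G d == u) && (src G (rev_dart d) == v)]].

Definition connected_graph : Prop :=
  (0 < #|vertex G|)%N /\ forall u v : vertex G, connect adjacent u v.

(* For a connected graph, the surface carrying the rotation system is the
   sphere if and only if Euler's formula holds.                                *)
Definition connected_plane_graph : Prop :=
  connected_graph /\ (#|vertex G| + #|faces| = m + 2)%N.

Definition is_loop (e : 'I_m) : bool := src G (e, false) == src G (e, true).

Definition incident (v : vertex G) (e : 'I_m) : bool :=
  [exists b : bool, src G (e, b) == v].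

Definition incidence_mx : 'M['F_2]_(#|vertex G|, m) :=
  \matrix_(i, e) (incident (enum_val i) e && ~~ is_loop e)%:R.

Definition cocycle_space : {vspace 'rV['F_2]_m} :=
  <<[seq row i incidence_mx | i : 'I_#|vertex G|]>>%VS.

End EmbeddedGraph.

Section Dual.
Variables (m : nat) (G : embedded_graph m).

Lemma left_face_subproof (d : dart m) : porbit (face_perm G) d \in faces G.
Proof.
rewrite /faces; case: eqP => [m0|_]; last exact: imset_f.
by have := leq_trans (ltn_ord d.1) (eq_leq m0).
Qed.

Definition left_face (d : dart m) : {f : {set dart m} | f \in faces G} :=
  exist (fun f : {set dart m} => f \in faces G) _ (left_face_subproof d).

Lemma left_faceP (d d' : dart m) :
  (left_face d == left_face d') = (d' \in porbit (face_perm G) d).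
Proof. by rewrite -val_eqE /= eq_porbit_mem porbit_sym. Qed.

(* The end [d] of the dual of an edge lies in the face to the left of [d], so
   that the dual edge joins the faces on both sides.                           *)
Definition dual : embedded_graph m := EmbeddedGraph left_faceP.

End Dual.

(** * The medial graph *)

(* The medial graph has the edges of [G] as vertices and the corners
   [(d, rot d)] as arcs. The half-arc [(d, true)] belongs to the corner
   [(d, rot d)] and [(d, false)] to the corner [(rot^-1 d, d)]; both end at the
   midpoint of the edge [d.1].                                                 *)
Definition half_arc (m : nat) : finType := (dart m * bool)%type.

Section Medial.
Variables (m : nat) (G : embedded_graph m).

Definition midpoint (h : half_arc m) : 'I_m := h.1.1.

(* The other half of the same arc. *)
Definition arc_mate (h : half_arc m) : half_arc m :=
  if h.2 then (rot G h.1, false) else ((rot G)^-1%g h.1, true).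

(* The next half-arc counterclockwise around the midpoint. *)
Definition medial_rot (h : half_arc m) : half_arc m :=
  if h.2 then (h.1, false) else (rev_dart h.1, true).

Definition opposite (h : half_arc m) : half_arc m := medial_rot (medial_rot h).

Definition straight_ahead : rel (half_arc m) :=
  [rel h h' | (h' == arc_mate h) || (h' == opposite h)].

(* A component is represented by the set of its half-arcs; the circle that is
   the medial graph of an edgeless graph has none.                             *)
Definition medial_components : {set {set half_arc m}} :=
  if m == 0%N then [set set0]
  else [set [set h' | connect straight_ahead h h'] | h : half_arc m].

(* Each passage through a midpoint uses two half-arcs. *)
Definition passages (k : {set half_arc m}) (e : 'I_m) : nat :=
  #|[set h in k | midpoint h == e]|./2.

Definition component_vector (k : {set half_arc m}) : 'rV['F_2]_m :=
  \row_e (odd (passages k e))%:R.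

End Medial.

(** * Choices of edges *)

(* Whether such an [e] exists depends on the order of the family [v]: for the
   path with two edges, both doubled, the curves have vectors 1111, 1100, 0011,
   and there is none if [v] starts with 1111, 1100.                            *)
Definition admissible (m n : nat) (v : 'I_n -> 'rV['F_2]_m)
    (e : 'I_n -> 'I_m) : Prop :=
  forall j : 'I_n, v j 0 (e j) = 1 /\
    (forall i : 'I_n, (i < j)%N -> v i 0 (e j) = 0).

(* Main.v *)
(* Let x be in the intersection of U and U*, the coboundary of a function a on
   the vertices and of a function b on the faces. Both corners met when going
   straight ahead through the midpoint of an edge have the same value of a + b,
   so a + b is constant along the curves of the medial graph, and x is a linear
   combination of their vectors. By connectivity dim U >= |V| - 1 and
   dim U* >= |F| - 1, so Euler's formula bounds the dimension of the quotient by
   that of the intersection, hence by c - 1. Conversely every v_j is orthogonal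
   to U + U*, and its pairing with the chosen edges is triangular, which makes
   their classes linearly independent.
   An admissible choice exists because a set of curves which does not contain
   the last one has, by connectivity, an edge traversed exactly once by exactly
   one of its members. *)

Require Import Defs.
From HB Require Import structures.
From mathcomp Require Import all_boot all_order all_fingroup all_algebra.

Set Implicit Arguments.
Unset Strict Implicit.
Unset Printing Implicit Defensive.

Import GRing.Theory.
Local Open Scope ring_scope.

(** * Arithmetic in GF(2) *)

Lemma addrr_F2 (x : 'F_2) : x + x = 0.
Proof. by rewrite -mulr2n -mulr_natr (pchar_Fp_0 (isT : prime 2)) mulr0. Qed.

Lemma natr_odd_F2 (n : nat) : (odd n)%:R = n%:R :> 'F_2.
Proof.
by rewrite -[in RHS](odd_double_half n) natrD -addnn natrD addrr_F2 addr0.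
Qed.

Lemma sum_dart (m : nat) (F : dart m -> 'F_2) :
  \sum_d F d = \sum_(e < m) (F (e, false) + F (e, true)).
Proof.
under [RHS]eq_bigr => e _ do
  rewrite addrC -(big_bool _ (fun b => F (e, b))).
by rewrite pair_bigA; apply: eq_bigr => -[].
Qed.

Lemma addr_F2_eq (x y : 'F_2) : x + y == 0 -> x = y.
Proof.
by rewrite addr_eq0 => /eqP->; apply/esym/eqP; rewrite -addr_eq0 addrr_F2.
Qed.

(** * Cut spaces as spaces of coboundaries *)

Section Cocycles.
Variables (m : nat) (G : embedded_graph m).

Lemma src_rot (d : dart m) : src G (Defs.rot G d) = src G d.
Proof. by apply/eqP; rewrite eq_sym srcP -{1}[Defs.rot G]expg1 mem_porbit. Qed.

(** At a loop the two summands cancel, matching the zero entry of the incidence matrix. *)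
Definition coboundary (a : vertex G -> 'F_2) : 'rV['F_2]_m :=
  \row_e (a (src G (e, false)) + a (src G (e, true))).

Lemma coboundaryE (a : vertex G -> 'F_2) (d : dart m) :
  coboundary a 0 d.1 = a (src G d) + a (src G (rev_dart d)).
Proof. by case: d => e [] //=; rewrite mxE // addrC. Qed.

Lemma mulmx_incidence (A : 'rV['F_2]_#|vertex G|) :
  A *m incidence_mx G = coboundary (fun u => A 0 (enum_rank u)).
Proof.
apply/rowP=> e; rewrite !mxE (reindex_onto enum_rank enum_val) /=; last first.
  by move=> i _; rewrite enum_valK.
under eq_bigl do rewrite enum_rankK eqxx.
under eq_bigr do rewrite mxE enum_rankK.
rewrite /is_loop; case: eqP => [->|/eqP ne].
  by rewrite addrr_F2 big1 // => u _; rewrite andbF mulr0.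
rewrite (bigD1 (src G (e, false))) //= (bigD1 (src G (e, true))) /=; last first.
  by rewrite eq_sym.
rewrite big1 => [|u /andP[n0 n1]].
  have inc b : incident (src G (e, b)) e by apply/existsP; exists b.
  by rewrite !inc !mulr1 addr0.
suff /negPf -> : ~~ incident u e by rewrite mulr0.
apply/existsP => -[[]]; rewrite eq_sym; exact/negP.
Qed.

Lemma limg_incidence :
  limg (linfun (mulmxr (incidence_mx G) : 'rV_#|vertex G| -> 'rV_m))
  = cocycle_space G.
Proof.
apply/eqP; rewrite eqEsubv; apply/andP; split.
  apply/subvP=> _ /memv_imgP[A _ ->]; rewrite lfunE /= mulmx_sum_row.
  apply: memv_suml => i _; apply/memvZ/memv_span/imageP; by exists i.
apply/span_subvP => _ /imageP[i _ ->].
by rewrite rowE; apply/memv_imgP; exists (delta_mx 0 i); rewrite ?memvf ?lfunE.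
Qed.

Lemma cocycleP (x : 'rV['F_2]_m) :
  x \in cocycle_space G -> exists a, x = coboundary a.
Proof.
rewrite -limg_incidence => /memv_imgP[A _ ->]; rewrite lfunE /= mulmx_incidence.
by eexists.
Qed.

(** Rank-nullity: by the hypothesis a function with zero coboundary is constant, so the kernel is at
    most a line. The hypothesis is kept abstract to serve both a graph and its dual. *)
Lemma dim_cocycle_space :
  (forall a : vertex G -> 'F_2,
     (forall d, a (src G d) = a (src G (rev_dart d))) ->
     forall u w, a u = a w) ->
  (#|vertex G| <= (\dim (cocycle_space G)).+1)%N.
Proof.
move=> const_a; set f := mulmxr (incidence_mx G) : 'rV_#|vertex G| -> 'rV_m.
have := limg_ker_dim (linfun f) fullv.
rewrite limg_incidence capfv dimvf /dim /= mul1n => <-.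
rewrite -[X in (_ <= X)%N]add1n leq_add2r.
apply: (@leq_trans (\dim <[const_mx 1 : 'rV['F_2]_#|vertex G|]>)); last first.
  by rewrite dim_vline leq_b1.
apply: dimvS; apply/subvP=> A; rewrite memv_ker lfunE /= => /eqP fA0.
have A_const u w : A 0 (enum_rank u) = A 0 (enum_rank w).
  apply: (const_a (fun u => A 0 (enum_rank u))) => d.
  have /rowP/(_ d.1) := fA0; rewrite mulmx_incidence coboundaryE mxE => /eqP.
  exact: addr_F2_eq.
apply/vlineP; case: (pickP 'I_#|vertex G|) => [i _|no_i]; last first.
  by exists 0; apply/rowP=> i; have := no_i i.
exists (A 0 i); apply/rowP=> j.
by rewrite !mxE mulr1 -(enum_valK i) -(enum_valK j).
Qed.

End Cocycles.

(** [face_perm] sends [rev_dart (rot d)] to [d]: both border the face at the corner [(d, rot d)]. *)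
Lemma left_face_rev_rot (m : nat) (G : embedded_graph m) (d : dart m) :
  left_face G (rev_dart (Defs.rot G d)) = left_face G d.
Proof.
have := src_rot (dual G) (rev_dart (Defs.rot G d)).
by rewrite /= face_permE rev_dartK permK => ->.
Qed.

(** * Connectivity of the graph and of its dual *)

Section Connectivity.
Variables (m : nat) (G : embedded_graph m).
Hypothesis G_conn : connected_graph G.

Lemma connected_vertex_const (T : Type) (a : vertex G -> T) :
  (forall d, a (src G d) = a (src G (rev_dart d))) -> forall u w, a u = a w.
Proof.
move=> a_rev u w; have /connectP[p] := G_conn.2 u w.
elim: p u => [u _ -> //|x p IHp u /= /andP[/existsP[d /andP[/eqP <- /eqP]]]].
by rewrite a_rev => -> px wE; apply: IHp.
Qed.

Lemma rot_invariant_src (T : Type) (b : dart m -> T) :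
  (forall d, b (Defs.rot G d) = b d) ->
  forall d d', src G d = src G d' -> b d = b d'.
Proof.
move=> b_rot d d' /eqP; rewrite srcP => /porbitP[i ->].
by elim: i => [|i IHi]; rewrite ?expg0 ?perm1 // expgSr permM b_rot.
Qed.

(** A path of vertices lifts to edge-ends: [rot] turns around a vertex, [rev_dart] crosses to the
    next one. *)
Lemma connected_dart_const (T : Type) (b : dart m -> T) :
  (forall d, b (Defs.rot G d) = b d) -> (forall d, b (rev_dart d) = b d) ->
  forall d d', b d = b d'.
Proof.
move=> b_rot b_rev d d'.
have b_src := @rot_invariant_src _ _ b_rot.
have /connectP[p] := G_conn.2 (src G d) (src G d').
elim: p d => [d _ /esym|x p IHp d /= /andP[/existsP[d1]]]; first exact: b_src.
case/andP=> /eqP d1d /eqP <- p1 d'E.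
by rewrite -(b_src _ _ d1d) -b_rev; apply: IHp.
Qed.

Lemma dual_vertex_const (b : vertex (dual G) -> 'F_2) :
  (forall d, b (src (dual G) d) = b (src (dual G) (rev_dart d))) ->
  forall f g, b f = b g.
Proof.
move=> b_rev f g.
have b_face d : b (left_face G (Defs.rot G d)) = b (left_face G d).
  by rewrite -[in RHS]left_face_rev_rot; apply: b_rev.
have b_const := connected_dart_const b_face (fun d => esym (b_rev d)).
(* The single face of an edgeless graph is to the left of no edge-end, so it is treated apart. *)
case: (posnP m) => [/eqP m0|m_gt0].
  have face0 h : h \in faces G -> h = set0 by rewrite /faces m0 inE => /eqP.
  by congr (b _); apply: val_inj; rewrite !(face0 _ (valP _)).
have face_src h : exists d, h = left_face G d.
  case: h => h hF; have := hF; rewrite {1}/faces gtn_eqF // => /imsetP[d _ hE].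
  by exists d; apply: val_inj.
have [[d ->] [d' ->]] := (face_src f, face_src g); exact: b_const.
Qed.

End Connectivity.

(** * Functions on corners and orthogonality to the cut spaces *)

Lemma corner_function (m : nat) (G : embedded_graph m) (x : 'rV['F_2]_m) :
  x \in (cocycle_space G :&: cocycle_space (dual G))%VS ->
  exists phi : half_arc m -> 'F_2,
    [/\ forall h, phi (arc_mate G h) = phi h,
        forall h, phi (opposite h) = phi h &
        forall d : dart m, x 0 d.1 = phi (d, true) + phi (d, false)].
Proof.
rewrite memv_cap => /andP[/cocycleP[a xa] /cocycleP[b xb]].
(* The value at the vertex plus the value at the face of the corner, which lies left of [d] for
   [(d, true)] and right of [d] for [(d, false)]. *)
exists (fun h => a (src G h.1)
  + b (left_face G (if h.2 then h.1 else rev_dart h.1))).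
have xb' d : x 0 d.1 = b (left_face G d) + b (left_face G (rev_dart d)).
  by rewrite xb coboundaryE.
split=> [[d []]|[d s]|d] /=.
- by rewrite src_rot left_face_rev_rot.
- by rewrite -src_rot -left_face_rev_rot permKV.
(* The opposite half-arc is at the other end and on the other side of the edge: both summands change
   by the entry of [x]. *)
- rewrite /opposite /medial_rot; case: s; rewrite /= ?rev_dartK.
  + apply: addr_F2_eq; rewrite addrACA [a _ + _]addrC [b _ + _]addrC -xb'.
    by rewrite -coboundaryE -xa addrr_F2.
  + apply: addr_F2_eq; rewrite addrACA -xb' [a _ + _]addrC -coboundaryE -xa.
    by rewrite addrr_F2.
- by rewrite addrACA addrr_F2 add0r xb'.
Qed.

Definition pairing (m : nat) (x y : 'rV['F_2]_m) : 'F_2 := \sum_e x 0 e * y 0 e.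

Lemma pairing_coboundary (m : nat) (H : embedded_graph m)
    (x : 'rV['F_2]_m) (a : vertex H -> 'F_2) :
  pairing (coboundary a) x = \sum_d a (src H d) * x 0 d.1.
Proof.
by rewrite sum_dart; apply: eq_bigr => e _; rewrite mxE mulrDl.
Qed.

(* Around a vertex the values f after each edge-end reappear as the values g
   before the next one, so that everything cancels in characteristic 2. *)
Lemma pairing_rot (m : nat) (H : embedded_graph m)
    (x y : 'rV['F_2]_m) (f g : dart m -> 'F_2) :
  y \in cocycle_space H ->
  (forall d, x 0 d.1 = f d + g d) -> (forall d, g (Defs.rot H d) = f d) ->
  pairing y x = 0.
Proof.
move=> /cocycleP[a ->] xE fg; rewrite pairing_coboundary.
under eq_bigr do rewrite xE mulrDr.
rewrite big_split /= [X in _ + X](reindex_inj (@perm_inj _ (Defs.rot H))) /=.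
by under [X in _ + X]eq_bigr do rewrite fg src_rot; rewrite addrr_F2.
Qed.

(** For the dual the two half-arcs of an edge-end exchange roles, and a step of [face_perm] is
    [opposite] followed by [arc_mate]. *)
Lemma pairing_cocycle_spaces (m : nat) (G : embedded_graph m)
    (phi : half_arc m -> 'F_2) (x y : 'rV['F_2]_m) :
  (forall h, phi (arc_mate G h) = phi h) ->
  (forall h, phi (opposite h) = phi h) ->
  (forall d : dart m, x 0 d.1 = phi (d, true) + phi (d, false)) ->
  y \in (cocycle_space G + cocycle_space (dual G))%VS ->
  pairing y x = 0.
Proof.
move=> phi_mate phi_opp xE /memv_addP[y1 y1U [y2 y2U ->]].
have pairingDl : pairing (y1 + y2) x = pairing y1 x + pairing y2 x.
  by rewrite -big_split; apply: eq_bigr => e _; rewrite mxE mulrDl.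
have phi_rot d : phi (Defs.rot G d, false) = phi (d, true).
  exact: (phi_mate (d, true)).
rewrite pairingDl (pairing_rot y1U xE) // add0r.
apply: (@pairing_rot _ _ _ _ (fun d => phi (d, false)) (fun d => phi (d, true))
  y2U) => d; first by rewrite addrC.
rewrite /= -phi_rot face_permE permKV.
exact: (phi_opp (d, false)).
Qed.

(** * Curves of the medial graph *)

Section Curves.
Variables (m : nat) (G : embedded_graph m).

Definition curve (h : half_arc m) : {set half_arc m} :=
  [set h' | connect (straight_ahead G) h h'].

Lemma arc_mateK : involutive (arc_mate G).
Proof. by case=> d []; rewrite /arc_mate /= ?permK ?permKV. Qed.

Lemma oppositeK : involutive (@opposite m).
Proof. by case=> d []; rewrite /opposite /medial_rot /= rev_dartK. Qed.

Lemma straight_ahead_connect_sym : connect_sym (straight_ahead G).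
Proof.
apply: sym_connect_sym => h h'; rewrite /straight_ahead /=.
by rewrite ![h' == _]eq_sym (inv_eq arc_mateK) (inv_eq oppositeK).
Qed.

Lemma straight_ahead_invariant (T : Type) (phi : half_arc m -> T) :
  (forall h, phi (arc_mate G h) = phi h) ->
  (forall h, phi (opposite h) = phi h) ->
  forall h h', h' \in curve h -> phi h' = phi h.
Proof.
move=> phi_mate phi_opp h h'; rewrite inE => /connectP[p].
elim: p h => [h _ -> //|h1 p IHp h /=].
case/andP=> [/orP[] /eqP -> p_path] /(IHp _ p_path).
  by rewrite phi_mate.
by rewrite phi_opp.
Qed.

Lemma mem_curve_self (h : half_arc m) : h \in curve h.
Proof. by rewrite inE. Qed.

Lemma curve_eq (h h' : half_arc m) : h' \in curve h -> curve h' = curve h.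
Proof.
rewrite inE => hh'; apply/setP=> h1; rewrite !inE.
by rewrite (same_connect straight_ahead_connect_sym hh').
Qed.

Lemma mem_curve_mate (h h1 : half_arc m) :
  (arc_mate G h1 \in curve h) = (h1 \in curve h).
Proof.
rewrite !inE; apply/esym/(same_connect_r straight_ahead_connect_sym).
by apply: connect1; rewrite /straight_ahead /= eqxx.
Qed.

Lemma mem_curve_opposite (h h1 : half_arc m) :
  (opposite h1 \in curve h) = (h1 \in curve h).
Proof.
rewrite !inE; apply/esym/(same_connect_r straight_ahead_connect_sym).
by apply: connect1; rewrite /straight_ahead /= eqxx orbT.
Qed.

(** The four half-arcs at a midpoint form two opposite pairs, each entirely on or off the curve;
    halving leaves one term per pair. *)
Lemma passages_curve (h : half_arc m) (d : dart m) :
  passages (curve h) d.1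
  = (((d, true) \in curve h) + ((d, false) \in curve h))%N.
Proof.
rewrite /passages; set k := curve h.
have k_opp e b s : ((e, b, s) \in k) = ((e, false, s) \in k).
  by case: b => //; rewrite -mem_curve_opposite; case: s.
pose F e b s : nat := ((e, b, s) \in k) && (e == d.1).
have -> : #|[set h1 in k | midpoint h1 == d.1]|
          = (\sum_e \sum_b \sum_s F e b s)%N.
  rewrite -sum1dep_card big_mkcond !pair_bigA /=.
  by apply: eq_bigr => -[[e b] s] _; rewrite /F /midpoint /=; case: andP.
rewrite /F (bigD1 d.1) //= [X in (_ + X)%N]big1 ?addn0 => [|e /negPf ne].
  rewrite !big_bool /= eqxx !andbT.
  case: (d) => e b; rewrite !(k_opp _ true) !(k_opp _ b).
  by do 2!case: (_ \in k).
by rewrite !big_bool ne !andbF.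
Qed.

Lemma component_vector_curve (h : half_arc m) (d : dart m) :
  component_vector (curve h) 0 d.1
  = ((d, true) \in curve h)%:R + ((d, false) \in curve h)%:R.
Proof. by rewrite mxE passages_curve natr_odd_F2 natrD. Qed.

End Curves.

(* The order is built from the end: the curve isolated in S is put after all the
   others of S. *)
Lemma greedy_admissible (m n : nat) (v : 'I_n -> 'rV['F_2]_m) :
  (forall S : {set 'I_n}, S != set0 -> exists i e,
     [/\ i \in S, v i 0 e = 1 & {in S, forall j, j != i -> v j 0 e = 0}]) ->
  exists (s : {perm 'I_n}) (e : 'I_n -> 'I_m), admissible (fun j => v (s j)) e.
Proof.
move=> lone.
have greedy (S : {set 'I_n}) : exists t : seq ('I_n * 'I_m),
    [/\ uniq (map fst t), map fst t =i S, all (fun p => v p.1 0 p.2 == 1) t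
      & pairwise (fun p q => v p.1 0 q.2 == 0) t].
  have [r] := ubnP #|S|; elim: r S => // r IHr S leSr.
  have [->|/lone[i [e [iS vi vj]]]] := eqVneq S set0.
    by exists [::]; split=> // i; rewrite inE.
  have [|t [t_uniq tE t1 t0]] := IHr (S :\ i).
    by move: leSr; rewrite (cardsD1 i) iS.
  exists (rcons t (i, e)); rewrite map_rcons rcons_uniq all_rcons pairwise_rcons.
  split.
  - by rewrite tE !inE eqxx.
  - by move=> j; rewrite mem_rcons inE tE !inE; case: eqVneq => [->|].
  - by rewrite /= vi eqxx.
  - rewrite t0 andbT; apply/allP=> p /(map_f fst); rewrite tE !inE /=.
    by case/andP=> pi pS; rewrite (vj _ pS pi).
have [t [t_uniq tE t1 t0]] := greedy setT.
have t_size : size t == n.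
  by rewrite -(size_map fst) -(card_uniqP t_uniq) (eq_card tE) cardsT card_ord.
pose tt := Tuple t_size.
(* The list contains every index once, so its first components form a permutation. *)
have s_inj : injective (fun j => (tnth tt j).1).
  move=> i j ij; apply: val_inj; apply/eqP.
  have x0 := tnth tt i.
  rewrite -(nth_uniq x0.1 _ _ t_uniq) ?size_map ?(eqP t_size) ?ltn_ord //.
  rewrite !(nth_map x0) ?(eqP t_size) ?ltn_ord //.
  by move: ij; rewrite !(tnth_nth x0) /= => ->.
exists (perm s_inj), (fun j => (tnth tt j).2) => j; rewrite permE; split.
  by apply/eqP/(allP t1)/mem_tnth.
move=> i ij; rewrite permE; apply/eqP.
have x0 := tnth tt i; rewrite !(tnth_nth x0).
by apply: (pairwiseP x0 t0) => //; rewrite inE (eqP t_size) ltn_ord.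
Qed.

(** * The vectors of the components *)

Section Components.
Variables (m n : nat) (G : embedded_graph m) (k : n.+1.-tuple {set half_arc m}).
Hypothesis k_uniq : uniq k.
Hypothesis k_all : k =i medial_components G.
Hypothesis m_gt0 : (0 < m)%N.

Let kk (j : 'I_n) := tnth k (widen_ord (leqnSn n) j).

Lemma tnth_curve (j : 'I_n.+1) : exists h, tnth k j = curve G h.
Proof.
have := mem_tnth j k; rewrite k_all /medial_components gtn_eqF //.
by case/imsetP=> h _ ->; exists h.
Qed.

Lemma curve_tnth (h : half_arc m) : exists j, tnth k j = curve G h.
Proof.
have : curve G h \in k.
  by rewrite k_all /medial_components gtn_eqF //; apply: imset_f.
by move/tnthP=> [j ->]; exists j.
Qed.

(** Curves are classes of an equivalence relation, so distinct entries of [k] are disjoint. *)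
Lemma mem_tnth_eq (h : half_arc m) (i j : 'I_n.+1) :
  h \in tnth k i -> (h \in tnth k j) = (i == j).
Proof.
have [[hi Ei] [hj Ej]] := (tnth_curve i, tnth_curve j) => hki.
apply/idP/eqP => [hkj|<- //]; apply: (tuple_uniqP _ k_uniq).
by rewrite Ei Ej in hki hkj *; rewrite -(curve_eq hki) -(curve_eq hkj).
Qed.

Lemma component_vectorE (j : 'I_n.+1) (d : dart m) :
  component_vector (tnth k j) 0 d.1
  = ((d, true) \in tnth k j)%:R + ((d, false) \in tnth k j)%:R.
Proof. by have [h ->] := tnth_curve j; apply: component_vector_curve. Qed.

(* The sum of the vectors of the curves in S is nonzero, and at most two curves
   pass through the midpoint of an edge where it is 1. *)
Lemma component_lone (G_conn : connected_graph G) (S : {set 'I_n}) :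
  S != set0 -> exists i e,
    [/\ i \in S, component_vector (kk i) 0 e = 1
     & {in S, forall j, j != i -> component_vector (kk j) 0 e = 0}].
Proof.
case/set0Pn=> i0 i0S.
pose phi h := [exists i in S, h \in kk i].
have kk_curve i : exists h, kk i = curve G h by exact: tnth_curve.
have phi_mate h : phi (arc_mate G h) = phi h.
  by apply: eq_existsb => i; have [h1 ->] := kk_curve i; rewrite mem_curve_mate.
have phi_opp h : phi (opposite h) = phi h.
  by apply: eq_existsb => i; have [h1 ->] := kk_curve i; rewrite mem_curve_opposite.
(* Otherwise connectivity makes [phi] constant, although it holds on the curve of [i0] and fails on
   the last curve. *)
have [d d_neq] : exists d, phi (d, true) != phi (d, false).
  apply/existsP; apply: contraT; rewrite negb_exists => /forallP phi_eq.
  have {}phi_eq d : phi (d, true) = phi (d, false)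
    by have := phi_eq d; rewrite negbK => /eqP.
  have phi_const := @connected_dart_const _ _ G_conn _ (fun d => phi (d, true)).
  have {}phi_const d d' : phi (d, true) = phi (d', true).
    apply: phi_const => d1; last exact: (phi_opp (d1, true)).
    by rewrite phi_eq; apply: (phi_mate (d1, true)).
  have {}phi_const h h' : phi h = phi h'.
    case: h h' => [d s] [d' s']; transitivity (phi (d, true)).
      by case: s.
    by rewrite (phi_const d d'); case: s'.
  have [h0 E0] := kk_curve i0.
  have [hn En] := tnth_curve ord_max.
  have := phi_const h0 hn.
  have -> : phi h0.
    by apply/existsP; exists i0; rewrite i0S E0 mem_curve_self.
  move/esym/existsP=> [i /andP[_]]; rewrite /kk.
  rewrite (@mem_tnth_eq _ ord_max) ?En ?mem_curve_self //.
  by move/eqP/(congr1 val)/eqP; rewrite /= gtn_eqF.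
(* [(d, ~~ s)] is on no curve of [S], so within [S] only the curve through [(d, s)] has a 1 at this
   edge. *)
pose s := phi (d, true).
have [phi_s phi_ns] : phi (d, s) /\ phi (d, ~~ s) = false.
  by rewrite /s; case E1: (phi (d, true)) d_neq; case E0: (phi (d, false)).
have vE j : component_vector (kk j) 0 d.1
    = ((d, s) \in kk j)%:R + ((d, ~~ s) \in kk j)%:R.
  by rewrite component_vectorE; case: (s) => //; rewrite addrC.
have in_ns j : j \in S -> ((d, ~~ s) \in kk j) = false.
  move=> jS; apply: contraFF phi_ns => dj.
  by apply/existsP; exists j; rewrite jS.
have /existsP[i /andP[iS di]] := phi_s.
exists i, d.1; split=> // [|j jS ji]; rewrite vE in_ns // addr0 ?di //.
rewrite (mem_tnth_eq _ di); case: eqP => // /(congr1 val) /= ij.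
by rewrite -val_eqE /= ij eqxx in ji.
Qed.

(* Adding a constant to phi, so that it vanishes on the last curve, does not
   change the sums of phi over the two corners of an edge-end. *)
Lemma corner_function_span (phi : half_arc m -> 'F_2) (x : 'rV['F_2]_m) :
  (forall h, phi (arc_mate G h) = phi h) ->
  (forall h, phi (opposite h) = phi h) ->
  (forall d : dart m, x 0 d.1 = phi (d, true) + phi (d, false)) ->
  x \in <<[seq component_vector (kk j) | j : 'I_n]>>%VS.
Proof.
move=> phi_mate phi_opp xE.
have phi_curve := straight_ahead_invariant phi_mate phi_opp.
have [hn En] := tnth_curve ord_max.
(* The shifted value of [phi] on the curve; the default 0 never occurs, since every curve contains a
   half-arc. *)
pose c j := if [pick h in kk j] is Some h then phi h + phi hn else 0.
have phiE h : phi h + phi hn = \sum_j c j * (h \in kk j)%:R.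
  have [i Ei] := curve_tnth h; have hi : h \in tnth k i.
    by rewrite Ei mem_curve_self.
  under eq_bigr do rewrite (mem_tnth_eq _ hi).
  case: (unliftP ord_max i) => [j ij|i_max].
    have {}ij : i = widen_ord (leqnSn n) j.
      by rewrite ij; apply: val_inj; rewrite /= /bump leqNgt ltn_ord.
    rewrite (bigD1 j) //= ij eqxx mulr1 big1 ?addr0 => [|j' j'j].
      rewrite /c; case: pickP => [h1|/(_ h)]; rewrite /kk -ij ?hi // Ei.
      by move/phi_curve->.
    by rewrite -val_eqE /= val_eqE eq_sym (negPf j'j) mulr0.
  (* On the last curve both sides vanish. *)
  rewrite (phi_curve hn h) ?addrr_F2 -?En -?i_max //.
  by rewrite big1 // => j _; rewrite i_max -val_eqE /= gtn_eqF ?mulr0.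
have -> : x = \sum_j c j *: component_vector (kk j).
  apply/rowP=> e; rewrite summxE (xE (e, false)).
  transitivity ((phi (e, false, true) + phi hn)
                + (phi (e, false, false) + phi hn)).
    by rewrite addrACA addrr_F2 addr0.
  rewrite !phiE -big_split /=.
  by apply: eq_bigr => j _; rewrite mxE (component_vectorE _ (e, false)) mulrDr.
apply: memv_suml => j _; apply/memvZ/memv_span/imageP; by exists j.
Qed.

(** The indicator function of a curve is invariant under [arc_mate] and [opposite], so the
    orthogonality result applies to it. *)
Lemma pairing_component (j : 'I_n.+1) (y : 'rV['F_2]_m) :
  y \in (cocycle_space G + cocycle_space (dual G))%VS ->
  pairing y (component_vector (tnth k j)) = 0.
Proof.
apply: (@pairing_cocycle_spaces _ _ (fun h => (h \in tnth k j)%:R)).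
- by move=> h; have [h1 ->] := tnth_curve j; rewrite mem_curve_mate.
- by move=> h; have [h1 ->] := tnth_curve j; rewrite mem_curve_opposite.
- exact: component_vectorE.
Qed.

End Components.

(** * Dimension of the quotient and independence of the edge classes *)

Lemma dim_quotv (K : fieldType) (vT : vectType K) (W : {vspace vT}) :
  \dim {:quotv W} = (\dim {:vT} - \dim W)%N.
Proof. by rewrite dimvf -dimv_compl. Qed.

(** The dimensions of sum and intersection add up to those of the two cut spaces, hence to at least
    [|V| + |F| - 2 = m]. *)
Lemma dim_quotv_cocycle_spaces (m : nat) (G : embedded_graph m) :
  connected_plane_graph G ->
  (\dim {:quotv (cocycle_space G + cocycle_space (dual G))%VS}
   <= \dim (cocycle_space G :&: cocycle_space (dual G)))%N.
Proof.
case=> G_conn euler; rewrite dim_quotv dimvf /dim /= mul1n leq_subLR.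
rewrite dimv_sum_cap.
have dimU := dim_cocycle_space (@connected_vertex_const _ _ G_conn _).
have dimU' := dim_cocycle_space (@dual_vertex_const _ _ G_conn).
have cardF : #|vertex (dual G)| = #|faces G| by rewrite /= card_sig.
rewrite cardF in dimU'; have := leq_add dimU dimU'.
by rewrite euler addSn !addnS addn0 !ltnS.
Qed.

Lemma admissible_free (m n : nat) (v : 'I_n -> 'rV['F_2]_m) (e : 'I_n -> 'I_m)
    (W : {vspace 'rV['F_2]_m}) :
  admissible v e -> (forall j y, y \in W -> pairing y (v j) = 0) ->
  free [seq quotv_pi W (delta_mx 0 (e j)) | j : 'I_n].
Proof.
move=> ve Wv.
have -> : [seq quotv_pi W (delta_mx 0 (e j)) | j : 'I_n]
    = [tuple quotv_pi W (delta_mx 0 (e j)) | j < n] by [].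
apply/freeP=> a.
under eq_bigr do rewrite -tnth_nth tnth_mktuple -linearZ.
rewrite -linear_sum -(linear0 (quotv_pi W)) => /quotv_piP; rewrite subr0 => aW.
(* A combination of class zero lies in [W], so it is orthogonal to every [v i]. *)
have a_v i : \sum_j a j * v i 0 (e j) = 0.
  rewrite -[RHS](Wv i _ aW) /pairing.
  under [RHS]eq_bigr do rewrite summxE mulr_suml.
  rewrite exchange_big; apply: eq_bigr => j _.
  rewrite (bigD1 (e j)) //= big1 ?addr0 => [|e' /negPf e'e]; rewrite !mxE /=.
    by rewrite eqxx mulr1.
  by rewrite e'e mulr0 mul0r.
(* Upward induction: terms with [j < i] vanish by induction, those with [j > i] because [v i] is 0
   at [e j]. *)
move=> i; have [r] := ubnP i; elim: r i => // r IHr i leir.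
have := a_v i; rewrite (bigD1 i) //= big1 => [|j ji].
  by rewrite (ve i).1 mulr1 addr0.
have [ij|] := ltnP i j; first by rewrite (ve j).2 ?mulr0.
rewrite leq_eqVlt val_eqE (negPf ji) /= => ji_lt.
by rewrite IHr ?mul0r // (leq_trans ji_lt).
Qed.

Theorem theorem4p3 (m c : nat) (G : embedded_graph m)
    (k : c.-tuple {set half_arc m})
    (G_plane : connected_plane_graph G)
    (k_uniq : uniq k)
    (k_all : k =i medial_components G) :
  let v (j : 'I_c.-1) : 'rV['F_2]_m :=
    component_vector (tnth k (widen_ord (leq_pred c) j)) in
  let W := (cocycle_space G + cocycle_space (dual G))%VS in
  (exists (s : {perm 'I_c.-1}) (e : 'I_c.-1 -> 'I_m),
     admissible (fun j => v (s j)) e) /\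
  (forall e : 'I_c.-1 -> 'I_m, admissible v e ->
     basis_of (fullv : {vspace quotv W})
       [seq quotv_pi W (delta_mx 0 (e j)) | j : 'I_c.-1]).
Proof.
have cE : c = #|medial_components G|.
  by rewrite -(size_tuple k) -(card_uniqP k_uniq) (eq_card k_all).
have c_m0 : m = 0%N -> c = 1%N.
  by move=> m0; rewrite cE /medial_components (introT eqP m0) cards1.
(* [c = 0] is impossible: an edgeless graph has one component, and any edge lies on a curve. *)
case: c k k_uniq k_all cE c_m0 => [|n] k k_uniq k_all cE c_m0 v W.
  case: (posnP m) => [/c_m0 // | m_gt0].
  move/esym/eqP: cE; rewrite cards_eq0 /medial_components gtn_eqF //.
  move/eqP/setP/(_ (curve G (Ordinal m_gt0, true, true))).
  by rewrite inE imset_f.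
have vE j : v j = component_vector (tnth k (widen_ord (leqnSn n) j)).
  by congr (component_vector (tnth k _)); apply: val_inj.
split.
  apply: greedy_admissible => S S0; case: (posnP m) => [/c_m0 [n0]|m_gt0].
    by case/set0Pn: S0 => i; have := ltn_ord i; rewrite {2}n0.
  have [i [e [iS vi vj]]] := component_lone k_uniq k_all m_gt0 G_plane.1 S0.
  by exists i, e; split=> [||j jS ji]; rewrite ?vE // vj.
(* It remains to show independence and that the quotient has dimension at most [n]. *)
move=> e ve; rewrite basisEfree subvf /= size_map -cardE card_ord.
apply/andP; split.
  apply: admissible_free ve _ => j y yW; rewrite vE.
  case: (posnP m) => [m0|m_gt0]; last exact: pairing_component yW.
  by rewrite /pairing big1 // => e'; have := ltn_ord e'; rewrite {2}m0.
apply: leq_trans (dim_quotv_cocycle_spaces G_plane) _.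
case: (posnP m) => [m0|m_gt0].
  apply: leq_trans (dimvS (subvf _)) _.
  by rewrite dimvf /dim /= mul1n m0.
apply: (@leq_trans (\dim <<[seq v j | j : 'I_n]>>%VS)); last first.
  by apply: leq_trans (dim_span _) _; rewrite size_map -cardE card_ord.
apply/dimvS/subvP=> x /corner_function[phi [phi_mate phi_opp xE]].
rewrite (eq_image (frefl _) vE).
exact: corner_function_span phi_mate phi_opp xE.
Qed.
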